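(* Let $\langle[0,1],\oplus_p\rangle$ and $\langle[0,1],\oplus'_p\rangle$ be convex algebras that satisfy (MO), (UC), (LC). Then they are isomorphic if and only if (i) there exists an increasing bijection $\varphi:E^\oplus\to E^{\oplus'}$ such that for all $(a,b)\in\Delta^\oplus$ one has $\tau^\oplus_{a,b}=\tau^{\oplus'}_{\varphi(a),\varphi(b)}$ (note that $(\varphi\times\varphi)(\Delta^\oplus)=\Delta^{\oplus'}$), and (ii) $\max E^\oplus<1$ if and only if $\max E^{\oplus'}<1$.
   Context: A convex algebra $\langle X,\oplus_p\rangle$ is a set $X$ with binary operations $\oplus_p$, $p\in(0,1)$, satisfying, for all $x,y,z\in X$ and $p,q\in(0,1)$: $x\oplus_p x=x$; $x\oplus_p y=y\oplus_{1-p}x$; and $(x\oplus_p y)\oplus_q z=x\oplus_{pq}\big(y\oplus_{\frac{(1-p)q}{1-pq}}z\big)$. Isomorphisms are bijections preserving all $\oplus_p$. For a convex subset $X\subseteq\mathbb R$, $x+_p y=px+(1-p)y$. On $[0,1]$, order and topology are the usual ones. Conditions on a convex algebra $\langle[0,1],\oplus_p\rangle$: (MO): for all $x,x',y\in[0,1]$, $p\in(0,1)$, $x\le x'$ implies $x\oplus_p y\le x'\oplus_p y$. (UC): for all $x,y\in[0,1)$, $p\in(0,1)$, $\limsup_{\varepsilon\to0+}[(x+\varepsilon)\oplus_p(y+\varepsilon)]\le x\oplus_p y$. (LC): for all $x\le y$ in $[0,1]$, $\liminf_{p\to1-}[y\oplus_p x]\ge y$. Write $y\triangleright x$ if $y\oplus_t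 x=y$ for all $t\in(0,1]$. $E^\oplus=\{y\in[0,1]:y\triangleright0\}$ (a closed set containing $0$ under these assumptions), $\Delta^\oplus=\{(a,b): a,b\in E^\oplus, a<b, (a,b)\cap E^\oplus=\emptyset\}$. For an algebra satisfying (MO),(UC),(LC) and $(a,b)\in\Delta^\oplus$, $\tau^\oplus_{a,b}$ denotes the unique element $\tau\in\{1,\infty\}$ such that the subalgebra $\langle[a,b),\oplus_p\rangle$ is isomorphic to $\langle[0,\tau),+_p\rangle$ (such $\tau$ exists and is unique). The same notation with $\oplus'$ refers to the second algebra. *)

(* Defs.v *)
From mathcomp Require Import all_boot all_order all_algebra.
From mathcomp Require Import all_classical all_reals all_analysis.
Set Implicit Arguments.
Unset Strict Implicit.
Unset Printing Implicit Defensive.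
Import Order.TTheory GRing.Theory Num.Theory.
Import numFieldNormedType.Exports.
Local Open Scope classical_set_scope.
Local Open Scope ring_scope.

(* A convex algebra is given by a carrier set A in an ambient type T and an
   operation [op p x y]; only the values with 0 < p < 1 and x, y in A matter.
   In this way a subalgebra is a smaller carrier with the same [op]. *)
Record convex_algebra (R : realType) (T : Type) (A : set T)
    (op : R -> T -> T -> T) : Prop := ConvexAlgebra {
  ca_closed : forall p x y, 0 < p < 1 -> A x -> A y -> A (op p x y) ;
  ca_idem : forall p x, 0 < p < 1 -> A x -> op p x x = x ;
  ca_comm : forall p x y, 0 < p < 1 -> A x -> A y ->
    op p x y = op (1 - p) y x ;
  ca_assoc : forall p q x y z, 0 < p < 1 -> 0 < q < 1 ->
    A x -> A y -> A z ->
    op q (op p x y) z =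
    op (p * q) x (op (((1 - p) * q) / (1 - p * q)) y z)
}.

Definition ca_isomorphic (R : realType) (T U : Type)
    (A : set T) (op : R -> T -> T -> T)
    (B : set U) (op' : R -> U -> U -> U) : Prop :=
  exists f : T -> U, set_bij A B f /\
    forall p x y, 0 < p < 1 -> A x -> A y ->
      f (op p x y) = op' p (f x) (f y).

Section UnitInterval.
Variable R : realType.
Implicit Types (op : R -> R -> R -> R) (a b x y : R) (A : set R).

Definition stdop (p x y : R) : R := p * x + (1 - p) * y.

Definition MO op : Prop := forall p x x' y,
  0 < p < 1 -> 0 <= x <= 1 -> 0 <= x' <= 1 -> 0 <= y <= 1 ->
  x <= x' -> op p x y <= op p x' y.

(* For x, y < 1 the points x + e and y + e lie in [0, 1] for all small e > 0,
   so the limsup does not see values of [op] outside the carrier. *)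
Definition UC op : Prop := forall p x y,
  0 < p < 1 -> 0 <= x < 1 -> 0 <= y < 1 ->
  (limf_esup (fun e : R => (op p (x + e)%R (y + e)%R)%:E) (0 : R)^'+
     <= (op p x y)%:E)%E.

Definition LC op : Prop := forall x y,
  0 <= x <= 1 -> 0 <= y <= 1 -> x <= y ->
  (y%:E <= limf_einf (fun p : R => (op p y x)%:E) (1 : R)^'-)%E.

(* The range of t is (0, 1]; the instance t = 1 is the convention
   op 1 y x = y and carries no content, so it is left out. *)
Definition triangle op y x : Prop := forall t, 0 < t < 1 -> op t y x = y.

Definition Eset op : set R := [set y | 0 <= y <= 1 /\ triangle op y 0].

Definition Delta op : set (R * R) := [set ab |
  [/\ Eset op ab.1, Eset op ab.2, ab.1 < ab.2 &
      `]ab.1, ab.2[%classic `&` Eset op = set0]].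

(* The default value 0 is returned only when no suitable t exists. *)
Definition tau op a b : \bar R := xget 0%E [set t : \bar R |
  (t = 1%:E \/ t = +oo%E) /\
  ca_isomorphic `[a, b[%classic op
    [set x : R | 0 <= x /\ (x%:E < t)%E] stdop].

(* The default value 0 is returned only when A has no greatest element. *)
Definition max_of A : R := xget 0 (A `&` ubound A).

End UnitInterval.

(* Main.v *)
Require Import Defs.
From mathcomp Require Import all_boot all_order all_algebra.
From mathcomp Require Import all_classical all_reals all_analysis.
From mathcomp Require Import ring lra.
Import Order.TTheory GRing.Theory Num.Theory.
Import numFieldNormedType.Exports.
Local Open Scope classical_set_scope.
Local Open Scope ring_scope.

(** On [[0, 1]], the elements of E are exactly those absorbing everything
    below them, so x +_p y with x < b <= y and b in E equals b +_p y.  Hence the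
    algebra is glued from its fibers over E, where the fiber of a consists of
    the points whose largest minorant in E is a.  In a fiber, (LC) and (UC) make
    every ray p |-> y +_p a a strictly increasing bijection onto (a, y), and
    measuring points along one ray identifies the fiber with {0}, [0, 1),
    [0, oo) or (for the topmost fiber only) [0, 1].  Isomorphisms of fibers
    glue; conversely, E \ {0} is algebraically definable as the set of elements
    absorbing some other element. *)

Section UnitIntervalAlgebra.
Set Implicit Arguments.
Unset Strict Implicit.
Context {R : realType}.
Variable op : R -> R -> R -> R.
Hypothesis hop : convex_algebra `[0, 1]%classic op.
Hypothesis hMO : MO op.
Hypothesis hUC : UC op.
Hypothesis hLC : LC op.
Implicit Types (p q r s t x y z a b c d e w : R).

(** * Identities in a convex algebra on [0, 1] *)

Lemma in_I x : 0 <= x <= 1 -> `[0, 1]%classic x.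
Proof. by rewrite /= in_itv. Qed.

Lemma op_I p x y : 0 < p < 1 -> 0 <= x <= 1 -> 0 <= y <= 1 -> 0 <= op p x y <= 1.
Proof.
move=> p01 /in_I xI /in_I yI.
by have := ca_closed hop p01 xI yI; rewrite /= in_itv.
Qed.

Lemma op_xx p x : 0 < p < 1 -> 0 <= x <= 1 -> op p x x = x.
Proof. by move=> p01 /in_I xI; rewrite (ca_idem hop). Qed.

Lemma op_comm p x y : 0 < p < 1 -> 0 <= x <= 1 -> 0 <= y <= 1 ->
  op p x y = op (1 - p) y x.
Proof. by move=> p01 /in_I xI /in_I yI; rewrite (ca_comm hop). Qed.

(** Fixing the inner weight [r] by an equation without division leaves only polynomial side
    conditions. *)
Lemma op_assoc p q r x y z : 0 < p < 1 -> 0 < q < 1 ->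
  r * (1 - p * q) = (1 - p) * q ->
  0 <= x <= 1 -> 0 <= y <= 1 -> 0 <= z <= 1 ->
  op q (op p x y) z = op (p * q) x (op r y z).
Proof.
move=> p01 q01 rE /in_I xI /in_I yI /in_I zI; rewrite (ca_assoc hop)//.
by congr (op _ _ (op _ _ _)); rewrite -rE mulfK//; apply/eqP; nra.
Qed.

(** Associativity brings the two copies of [a] together and idempotence merges them, so successive
    contractions towards [a] multiply their weights. *)
Lemma op_mulr p q y a : 0 < p < 1 -> 0 < q < 1 -> 0 <= y <= 1 -> 0 <= a <= 1 ->
  op p (op q y a) a = op (p * q) y a.
Proof.
move=> p01 q01 yI aI.
have pq : 0 < 1 - q * p by nra.
rewrite (@op_assoc _ _ ((1 - q) * p / (1 - q * p)))// ?divfK ?gt_eqF//.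
rewrite op_xx ?(mulrC q)//; rewrite (mulrC q) in pq.
by rewrite divr_gt0 ?ltr_pdivrMr//=; nra.
Qed.

Lemma op_addr p q y a : 0 < p < 1 -> 0 < q < 1 -> 0 <= y <= 1 -> 0 <= a <= 1 ->
  op p y (op q y a) = op (p + (1 - p) * q) y a.
Proof.
move=> p01 q01 yI aI.
rewrite op_comm ?op_I// (op_comm q01)// op_mulr//; [|lra|lra].
by rewrite op_comm//; [congr op; ring|nra].
Qed.

Lemma op_hom p s t y a : 0 < p < 1 -> 0 < s < 1 -> 0 < t < 1 ->
  0 <= y <= 1 -> 0 <= a <= 1 ->
  op p (op s y a) (op t y a) = op (p * s + (1 - p) * t) y a.
Proof.
move=> p01 s01 t01 yI aI.
have ps : 0 < 1 - s * p by nra.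
set r := (1 - s) * p / (1 - s * p).
have rE : r * (1 - s * p) = (1 - s) * p by rewrite divfK ?gt_eqF.
have r01 : 0 < r < 1 by rewrite divr_gt0 ?ltr_pdivrMr//=; nra.
rewrite (@op_assoc _ _ r)// ?op_I// (op_comm r01) ?op_I//.
rewrite op_mulr//; [|lra]; rewrite op_addr//; [congr op|nra|nra].
have -> : (1 - s * p) * ((1 - r) * t) = ((1 - s * p) - r * (1 - s * p)) * t by ring.
by rewrite rE; ring.
Qed.

(** Makes contraction towards [a] an endomorphism, so that points can be compared after
    contracting. *)
Lemma op_opl p s x y a : 0 < p < 1 -> 0 < s < 1 ->
  0 <= x <= 1 -> 0 <= y <= 1 -> 0 <= a <= 1 ->
  op s (op p x y) a = op p (op s x a) (op s y a).
Proof.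
move=> p01 s01 xI yI aI.
have ps : 0 < 1 - p * s by nra.
have ps' : 0 < 1 - s * p by nra.
set r := (1 - s) * p / (1 - s * p).
have rE : r * (1 - s * p) = (1 - s) * p by rewrite divfK ?gt_eqF.
have r01 : 0 < r < 1 by rewrite divr_gt0 ?ltr_pdivrMr//=; nra.
rewrite [RHS](@op_assoc _ _ r)// ?op_I// (op_comm r01) ?op_I//.
rewrite op_mulr//; [|lra]; rewrite mulrC; apply: op_assoc => //.
rewrite (_ : _ * _ = s * ((1 - s * p) - r * (1 - s * p))); last by ring.
by rewrite rE; ring.
Qed.

(** * Monotonicity, and working forms of (LC) and (UC) *)

Lemma op_mono p x x' y y' : 0 < p < 1 -> 0 <= x -> x <= x' <= 1 ->
  0 <= y -> y <= y' <= 1 -> op p x y <= op p x' y'.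
Proof.
move=> p01 x0 /andP[xx' x'1] y0 /andP[yy' y'1].
apply: (@le_trans _ _ (op p x' y)); first by apply: hMO => //; lra.
have h z : 0 <= z <= 1 -> op p x' z = op (1 - p) z x' by move=> ?; apply: op_comm; lra.
by rewrite !h; [apply: hMO => //; lra|lra|lra].
Qed.

Lemma op_le p y a : 0 < p < 1 -> 0 <= a -> a <= y <= 1 -> a <= op p y a <= y.
Proof.
move=> p01 a0 /andP[ay y1]; apply/andP; split.
  by rewrite -{1}(@op_xx p a)//; [apply: op_mono => //; lra|lra].
by rewrite -{2}(@op_xx p y)//; [apply: op_mono => //; lra|lra].
Qed.

(** The smaller weight arises from the larger by a further contraction with weight [p / q], which
    cannot increase the value. *)
Lemma op_weight p q y a : 0 < p -> p <= q -> q < 1 -> 0 <= a -> a <= y <= 1 ->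
  op p y a <= op q y a.
Proof.
move=> p0; rewrite le_eqVlt => /predU1P[-> //|pq] q1 a0 ay.
have q0 : 0 < q by lra.
have q01 : 0 < q < 1 by lra.
have pq01 : 0 < p / q < 1 by rewrite divr_gt0 ?ltr_pdivrMr ?mul1r.
have /andP[h1 h2] := @op_le q y a q01 a0 ay.
rewrite -[in leLHS](divfK (lt0r_neq0 q0) p) -op_mulr//; [|lra|lra].
have /(op_le pq01 a0)/andP[_ //] : a <= op q y a <= 1 by lra.
Qed.

(** Form in which (LC) is used: the liminf is replaced by a single weight taken near 1. *)
Lemma LC_exists x y z : 0 <= x -> x <= y <= 1 -> z < y ->
  exists2 p, 0 < p < 1 & z < op p y x.
Proof.
move=> x0 xy zy.
have : (z%:E < limf_einf (fun p => (op p y x)%:E) (1 : R)^'-)%E.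
  by apply: lt_le_trans (hLC _ _ _); rewrite ?lte_fin//; lra.
rewrite limf_einfE => /ereal_sup_gt[_ [A A1 <-]] zA.
have /filter_ex[p [[Ap p0] p1]] : \forall p \near (1 : R)^'-, (A p /\ 0 < p) /\ p < 1.
  by apply: filterI; [apply: filterI => //; apply: nbhs_left_gt|apply: nbhs_left_lt].
exists p; first by rewrite p0.
rewrite -lte_fin; apply: lt_le_trans zA _.
by apply: ereal_inf_lbound; exists p.
Qed.

(** Form in which (UC) is used: a lower bound on a short diagonal segment above [(x, y)] passes to
    its end point. *)
Lemma UC_ge p x y c d : 0 < p < 1 -> 0 <= x < 1 -> 0 <= y < 1 -> 0 < d ->
  (forall e, 0 < e < d -> c <= op p (x + e) (y + e)) -> c <= op p x y.
Proof.
move=> p01 x01 y01 d0 h; rewrite -lee_fin; apply: le_trans (hUC p01 x01 y01).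
rewrite limf_esupE; apply: le_ereal_inf_tmp => _ [A A0 <-].
have /filter_ex[e [[Ae e0] ed]] : \forall e \near (0 : R)^'+, (A e /\ 0 < e) /\ e < d.
  apply: filterI; last exact: nbhs_right_lt.
  by apply: filterI => //; apply: nbhs_right_gt.
apply: (@le_trans _ _ (op p (x + e) (y + e))%:E).
  by rewrite lee_fin h// e0.
by apply: ereal_sup_ubound; exists e.
Qed.


(** * Iterated contractions *)

Lemma exists_expr_lt z e : 0 < z < 1 -> 0 < e -> exists n, z ^+ n < e.
Proof.
move=> z01 e0; have z1 : `|z| < 1 by rewrite ger0_norm; lra.
have /cvgr0Pnorm_lt/(_ e e0)[n _ /(_ n (leqnn n)) h] := cvg_expr z1.
exists n; apply: le_lt_trans h; exact: ler_norm.
Qed.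

(* If [op p v a] were [a], iterating [t |-> p + (1 - p) t] would
   push the weight of [v] to 1 without leaving [a], against LC. *)
Lemma op_gt p v a : 0 < p < 1 -> 0 <= a -> a < v <= 1 -> a < op p v a.
Proof.
move=> p01 a0 av.
have av' : a <= v <= 1 by lra.
rewrite lt_neqAle (andP (op_le p01 a0 av')).1 andbT; apply/eqP => ha.
have hn n : op (1 - (1 - p) ^+ n.+1) v a = a.
  elim: n => [|n IH]; first by rewrite expr1 subKr -ha.
  have e0 : 0 < (1 - p) ^+ n.+1 by apply: exprn_gt0; lra.
  have e1 : (1 - p) ^+ n.+1 < 1 by apply: exprn_ilt1 => //; lra.
  have : op p v (op (1 - (1 - p) ^+ n.+1) v a) = a by rewrite IH -ha.
  rewrite op_addr//; try lra; move=> h; rewrite -{2}h; congr op.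
  by rewrite [in LHS]exprS; ring.
have [q q01 aq] := LC_exists a0 av' (andP av).1.
have p01' : 0 < 1 - p < 1 by lra.
have q0 : 0 < 1 - q by lra.
have [n hq] := exists_expr_lt p01' q0.
have hp : 0 < (1 - p) ^+ n.+1 by apply: exprn_gt0; lra.
have hle : (1 - p) ^+ n.+1 <= (1 - p) ^+ n.
  by rewrite exprS ler_piMl ?exprn_ge0//; lra.
have := @op_weight q (1 - (1 - p) ^+ n.+1) v a.
rewrite hn => h; have : op q v a <= a by apply: h => //; lra.
by rewrite leNgt aq.
Qed.

(** All powers [r ^+ n.+1] fix [z] as well, and for large [n] they lie below [t]; monotonicity in
    the weight then forces [op t z a] up to [z]. *)
Lemma op_fix_weight r t z a : 0 < r < 1 -> 0 < t < 1 -> 0 <= a -> a <= z <= 1 ->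
  op r z a = z -> op t z a = z.
Proof.
move=> r01 t01 a0 az rz.
have hn n : op (r ^+ n.+1) z a = z.
  elim: n => [|n IH]; first by rewrite expr1.
  have e0 : 0 < r ^+ n.+1 by apply: exprn_gt0; lra.
  have e1 : r ^+ n.+1 < 1 by apply: exprn_ilt1 => //; lra.
  by rewrite exprS -op_mulr ?IH//; lra.
have [n hq] := exists_expr_lt r01 (andP t01).1.
have hp : 0 < r ^+ n.+1 by apply: exprn_gt0; lra.
have hle : r ^+ n.+1 <= r ^+ n by rewrite exprS ler_piMl ?exprn_ge0//; lra.
apply/eqP; rewrite eq_le (andP (op_le t01 a0 az)).2 /=.
by rewrite -{1}(hn n); apply: op_weight => //; lra.
Qed.

(** * Absorption and closedness of E *)

(** Otherwise [op t y 0 < op t y b], and (LC) contracts the larger point towards [b] while staying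
    above [op t y 0]. Contracting [op t y 0] towards [b] gives the same point, as [b] absorbs 0, but
    it cannot exceed [op t y 0]. *)
Lemma Eset_absorb b t x y : Eset op b -> 0 < t < 1 -> 0 <= x -> x <= b ->
  b <= y <= 1 -> op t y x = op t y b.
Proof.
move=> [bI b0] t01 x0 xb by1.
suff h : op t y b <= op t y 0.
  apply/eqP; rewrite eq_le; apply/andP; split; first by apply: op_mono => //; lra.
  by apply: le_trans h _; apply: op_mono => //; lra.
rewrite leNgt; apply/negP => hlt.
have h0 : b <= op t y 0.
  by rewrite -{1}(b0 t t01); apply: op_mono => //; lra.
have hI : 0 <= op t y b <= 1 by apply: op_I => //; lra.
have hI0 : 0 <= op t y 0 <= 1 by apply: op_I => //; lra.
have b0' : 0 <= b by lra.
have bw : b <= op t y b <= 1 by lra.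
have [s s01] := LC_exists b0' bw hlt.
rewrite op_mulr//; [|lra]; apply/negP; rewrite -leNgt.
rewrite -[leRHS](op_xx s01)//.
apply: (@le_trans _ _ (op s (op t y 0) b)); last by apply: op_mono => //; lra.
have ts : 0 < 1 - t * s by nra.
set r := (1 - t) * s / (1 - t * s).
have rE : r * (1 - t * s) = (1 - t) * s by rewrite divfK ?gt_eqF.
have r01 : 0 < r < 1 by rewrite divr_gt0 ?ltr_pdivrMr//=; nra.
rewrite (op_assoc t01 s01 rE)//; [|lra|lra].
rewrite [op r 0 b]op_comm//; [|lra]; rewrite b0; last lra.
by rewrite mulrC.
Qed.

(** If [y < z], then (LC) provides a combination of [z] and [y] strictly above [y], against
    absorption. *)
Lemma triangle_lt y z : 0 <= y <= 1 -> 0 <= z <= 1 -> triangle op y z -> z <= y.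
Proof.
move=> y01 z01 yz; rewrite leNgt; apply/negP => ltyz.
have yz1 : y <= z <= 1 by lra.
have [p p01] := LC_exists (andP y01).1 yz1 ltyz.
by rewrite op_comm// yz ?ltxx//; lra.
Qed.

Lemma Eset_triangle y z : Eset op y -> 0 <= z <= 1 ->
  triangle op y z <-> z <= y.
Proof.
move=> Ey z01; split; first by apply: triangle_lt => //; case: Ey.
move=> zy t t01; case: (Ey) => y01 y0.
by rewrite (Eset_absorb Ey)// ?op_xx//; lra.
Qed.

(** (LC) gives [s] with [z < op s y 0], so [y = op s y z] is at most [op s y (op s y 0)]. The latter
    is a contraction of [y] towards 0, which therefore fixes [y]; by [op_fix_weight] all of them
    do. *)
Lemma triangle_Eset y z : 0 <= z -> z < y <= 1 -> triangle op y z -> Eset op y.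
Proof.
move=> z0 zy yz; split; first lra.
have z0y : (0 : R) <= y <= 1 by lra.
have [s s01 ltzs] := LC_exists (lexx 0) z0y (andP zy).1.
suff h : op s y 0 = y by move=> t t01; apply: (op_fix_weight s01).
have [h0 h1] := andP (op_le s01 (lexx 0) z0y).
have : op s y z <= op s y (op s y 0) by apply: op_mono => //; lra.
rewrite (yz _ s01) op_addr//; last lra; move=> h3.
have s2 : 0 < s + (1 - s) * s < 1 by nra.
suff h4 : op (s + (1 - s) * s) y 0 = y by apply: op_fix_weight h4.
by apply/eqP; rewrite eq_le h3 andbT; case/andP: (op_le s2 (lexx 0) z0y).
Qed.

Lemma Eset_triangle_trans a z : Eset op a -> a <= z <= 1 ->
  triangle op z a -> Eset op z.
Proof.
move=> Ea az za; case: (Ea) => a01 _; split; first lra.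
by move=> t t01; rewrite (Eset_absorb Ea)// ?za//; lra.
Qed.

Lemma Eset0 : Eset op 0.
Proof. by split; [lra|move=> t t01; rewrite op_xx//; lra]. Qed.

(** By monotonicity each [x] in [S] satisfies [x = op t x 0 <= op t (sup S) 0]. *)
Lemma Eset_sup (S : set R) : S !=set0 -> S `<=` Eset op -> Eset op (sup S).
Proof.
move=> S0 SE.
have Sub : ubound S 1 by move=> x /SE[/andP[]].
have S1 : sup S <= 1 by apply: ge_sup.
have S0' : 0 <= sup S.
  case: (S0) => x Sx; apply: (@le_trans _ _ x); last by apply: ub_le_sup => //; exists 1.
  by have [/andP[]] := SE _ Sx.
split=> [|t t01]; first by rewrite S0'.
apply/eqP; rewrite eq_le (andP (@op_le t (sup S) 0 t01 _ _)).2//=; last by rewrite S0'.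
apply: ge_sup => // x Sx; have [x01 x0] := SE _ Sx; rewrite -(x0 t t01).
apply: op_mono => //; rewrite ?S1 ?andbT; try lra.
by apply: ub_le_sup => //; exists 1.
Qed.

(** Shifting [inf S] by [e] overtakes an element of [S], so (UC) bounds [op t (inf S) 0] below by
    [inf S]. *)
Lemma Eset_inf (S : set R) : S !=set0 -> S `<=` Eset op -> Eset op (inf S).
Proof.
move=> S0 SE.
have Slb : lbound S 0 by move=> x /SE[/andP[]].
have Shi : has_inf S by split => //; exists 0.
have Si x : S x -> inf S <= x by move=> Sx; apply: ge_inf => //; exists 0.
have S0' : 0 <= inf S by apply: lb_le_inf.
(* (UC) speaks only of points below 1; at 1 the infimum is itself an element of [S]. *)
have [S1|S1] := leP 1 (inf S).
  case: (S0) => x Sx; have [x01 _] := SE _ Sx; have := Si _ Sx.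
  by move=> ix; rewrite (_ : inf S = x); [exact: SE|lra].
split=> [|t t01]; first lra.
apply/eqP; rewrite eq_le (andP (@op_le t (inf S) 0 t01 _ _)).2//=; last lra.
apply: (@UC_ge t (inf S) 0 _ (1 - inf S)) => //; try lra.
move=> e e01; have e0 : 0 < e by lra.
have [x Sx xe] := inf_adherent e0 Shi.
have [x01 x0] := SE _ Sx; apply: le_trans (Si _ Sx) _; rewrite -(x0 t t01).
by apply: op_mono => //; lra.
Qed.

(** * Fibers over E and the rays inside them *)

Lemma mul_lt01 p q : 0 < p < 1 -> 0 < q < 1 -> 0 < p * q < 1.
Proof. by move=> p01 q01; nra. Qed.

Lemma conv_lt01 p q : 0 < p < 1 -> 0 < q < 1 -> 0 < p + (1 - p) * q < 1.
Proof. by move=> p01 q01; nra. Qed.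

(* For [a] in E: the points of [[0, 1]] whose largest minorant in E is [a]. *)
Definition fiber a : set R :=
  [set x | a <= x <= 1 /\ forall e, Eset op e -> e <= x -> e <= a].

Lemma fiber_base a : Eset op a -> fiber a a.
Proof. by move=> [a01 _]; split=> //; rewrite lexx; case/andP: a01. Qed.

Lemma fiber_down a x z : fiber a x -> a <= z <= x -> fiber a z.
Proof.
move=> [ax h] azx; split; first lra.
by move=> e Ee ez; apply: h => //; lra.
Qed.

Lemma fiber_op a p x y : Eset op a -> fiber a x -> fiber a y -> 0 < p < 1 ->
  fiber a (op p x y).
Proof.
move=> [a01 _] Cx Cy p01; wlog xy : p x y p01 Cx Cy / x <= y => [hw|].
  have [xy|yx] := leP x y; first exact: hw.
  case: (Cx) (Cy) => [x01 _] [y01 _].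
  by rewrite op_comm//; try lra; apply: hw => //; lra.
case: (Cx) (Cy) => [x01 _] [y01 _].
apply: fiber_down Cy _; rewrite op_comm//; try lra.
have p01' : 0 < 1 - p < 1 by lra.
have x0 : 0 <= x by lra.
have xy1 : x <= y <= 1 by lra.
by have := op_le p01' x0 xy1; lra.
Qed.

(** Equality for one weight would spread to all weights, so [x] would absorb [a] and lie in E above
    [a]. *)
Lemma fiber_op_lt a r x : Eset op a -> fiber a x -> a < x -> 0 < r < 1 ->
  op r x a < x.
Proof.
move=> Ea [x1 xE] ax r01; case: (Ea) => a01 _.
have a0 : 0 <= a by lra.
rewrite lt_neqAle (andP (op_le r01 a0 x1)).2 andbT; apply/eqP => h.
suff /(Eset_triangle_trans Ea x1)/xE : triangle op x a by lra.
by move=> t t01; apply: op_fix_weight h.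
Qed.

Lemma fiber_ray a p x : Eset op a -> fiber a x -> a < x -> 0 < p < 1 ->
  fiber a (op p x a) /\ a < op p x a.
Proof.
move=> Ea Cx ax p01; split; first exact/fiber_op/p01/fiber_base.
by case: (Ea) (Cx) => a01 _ [x1 _]; apply: op_gt => //; lra.
Qed.

Lemma fiber_ray_lt a p q x : Eset op a -> fiber a x -> a < x ->
  0 < p -> p < q -> q < 1 -> op p x a < op q x a.
Proof.
move=> Ea Cx ax p0 pq q1.
have q0 : 0 < q by lra.
have q01 : 0 < q < 1 by lra.
have pq01 : 0 < p / q < 1 by rewrite divr_gt0 ?ltr_pdivrMr ?mul1r.
have [Cq aq] := fiber_ray Ea Cx ax q01.
have := fiber_op_lt Ea Cq aq pq01.
case: (Ea) (Cx) => a01 _ [x1 _].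
by rewrite op_mulr ?divfK ?gt_eqF//; lra.
Qed.

(* The infimum of the ray from [a] towards [x] lies in E by UC, hence is [a]. *)
Lemma fiber_ray_small a x w : Eset op a -> fiber a x -> a < x -> a < w ->
  exists2 r, 0 < r < 1 & op r x a < w.
Proof.
move=> Ea Cx ax aw; case: (Ea) (Cx) => a01 _ [x1 xE].
have a0 : 0 <= a by lra.
pose S := [set op r x a | r in [set r | 0 < r < 1]].
have h2 : 0 < (2^-1 : R) < 1 by lra.
have S0 : S !=set0 by exists (op 2^-1 x a), 2^-1.
have Sa : lbound S a by move=> _ [r r01 <-]; rewrite (andP (op_le r01 a0 x1)).1.
have Shi : has_inf S by split=> //; exists a.
have Sle r : 0 < r < 1 -> inf S <= op r x a.
  by move=> r01; apply: ge_inf; [exists a|exists r].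
have aS : a <= inf S by apply: lb_le_inf.
have Sx : inf S < x.
  by apply: le_lt_trans (Sle _ h2) _; apply: (fiber_op_lt Ea).
suff Sa' : inf S = a.
  have wa : 0 < w - a by lra.
  have [_ [r r01 <-]] := inf_adherent wa Shi.
  by rewrite Sa' => hr; exists r => //; lra.
have aS1 : a <= inf S <= 1 by lra.
suff /(Eset_triangle_trans Ea aS1)/xE : triangle op (inf S) a by lra.
move=> t t01; apply/eqP; rewrite eq_le (andP (op_le t01 a0 aS1)).2/=.
apply: (@UC_ge t _ _ _ (1 - inf S)) => //; try lra.
move=> e e01; have e0 : 0 < e by lra.
have [_ [r r01 <-] hr] := inf_adherent e0 Shi.
(* Contracting a ray point below [inf S + e] by [t] gives another ray point, whose value is at least
   [inf S]. *)
have tr := mul_lt01 t01 r01.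
apply: le_trans (Sle _ tr) _.
have hrI : a <= op r x a <= x by apply: op_le => //; lra.
rewrite -op_mulr//; try lra.
by apply: op_mono => //; lra.
Qed.

(** The weight is the supremum of the [p] with [op p x a <= w]: exceeding [w] there contradicts
    (LC), staying below [w] contradicts (UC). *)
Lemma fiber_ray_surj a x w : Eset op a -> fiber a x -> a < w < x ->
  exists2 p, 0 < p < 1 & op p x a = w.
Proof.
move=> Ea Cx awx; case: (Ea) (Cx) => a01 _ [x1 xE].
have a0 : 0 <= a by lra.
have ax : a < x by lra.
pose S := [set p | 0 < p < 1 /\ op p x a <= w].
have [r r01 /ltW rw] := fiber_ray_small Ea Cx ax (andP awx).1.
have Sr : S r by [].
have [q q01 wq] := LC_exists a0 x1 (andP awx).2.
have Sq : ubound S q.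
  move=> p [p01 pw]; rewrite leNgt; apply/negP => qp.
  have : op q x a <= op p x a by apply: op_weight => //; lra.
  by lra.
have Shs : has_sup S by split; [exists r|exists q].
have Sle p : S p -> p <= sup S by apply: sup_upper_bound.
have Srs : r <= sup S by exact: Sle.
have Ssq : sup S <= q by apply: ge_sup => //; exists r.
have s01 : 0 < sup S < 1 by lra.
exists (sup S) => //; apply/eqP; rewrite eq_le; apply/andP; split.
  rewrite leNgt; apply/negP => hlt.
  have hI : a <= op (sup S) x a <= x by apply: op_le => //; lra.
  have hI1 : a <= op (sup S) x a <= 1 by lra.
  have [s s01' ws] := LC_exists a0 hI1 hlt.
  have sS : 0 < sup S - s * sup S by rewrite subr_gt0 gtr_pMl; lra.
  have sS0 : 0 < s * sup S by rewrite mulr_gt0; lra.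
  have [p [p01 pw] hp] := sup_adherent sS Shs.
  move: ws; rewrite op_mulr//; try lra; move=> ws.
  have : op (s * sup S) x a <= op p x a by apply: op_weight => //; lra.
  by lra.
(* Going through [y < x] keeps the base point of UC below 1. *)
pose s := (1 + sup S) / 2.
have s1 : sup S < s < 1 by rewrite /s; lra.
have s0 : 0 < s < 1 by lra.
pose p := sup S / s.
have pE : p * s = sup S by rewrite /p divfK//; lra.
have p01 : 0 < p < 1 by rewrite /p divr_gt0 ?ltr_pdivrMr ?mul1r//; lra.
rewrite -pE -op_mulr//; try lra.
have [Cy ay] := fiber_ray Ea Cx ax s0.
have yx := fiber_op_lt Ea Cx ax s0.
apply: (@UC_ge _ _ _ _ (1 - op s x a)) => //; try lra.
move=> e e01; have ae : a < a + e by lra.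
have [t t01 te] := fiber_ray_small Ea Cy ay ae.
have hI : a <= op t (op s x a) a <= op s x a by apply: op_le => //; lra.
apply: (@le_trans _ _ (op p (op s x a) (op t (op s x a) a))); last first.
  by apply: op_mono => //; lra.
have pt := conv_lt01 p01 t01.
rewrite op_addr//; try lra; rewrite op_mulr//; try lra.
(* Otherwise the combined weight would belong to [S] although it exceeds [p * s = sup S]. *)
rewrite leNgt; apply/negP => /ltW hS.
have : S ((p + (1 - p) * t) * s) by split=> //; exact: mul_lt01.
move/Sle; rewrite -pE leNgt => /negP; apply.
by rewrite ltr_pM2r; [rewrite ltrDl mulr_gt0; lra|lra].
Qed.

(** * Coordinates along a ray and the gauge of a fiber *)

(* [op u y a] extended by its limit [a] at [u = 0]. *)
Definition ray a y u : R := if u == 0 then a else op u y a.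

Lemma ray0 a y : ray a y 0 = a.
Proof. by rewrite /ray eqxx. Qed.

Lemma ray_gt0 a y u : 0 < u -> ray a y u = op u y a.
Proof. by rewrite /ray => u0; rewrite gt_eqF. Qed.

Lemma ray_hom p u v a y : 0 < p < 1 -> 0 <= u < 1 -> 0 <= v < 1 ->
  0 <= y <= 1 -> 0 <= a <= 1 ->
  op p (ray a y u) (ray a y v) = ray a y (p * u + (1 - p) * v).
Proof.
move=> p01 /andP[+ u1] /andP[+ v1] yI aI.
have p01' : 0 < 1 - p < 1 by lra.
rewrite !le_eqVlt => /predU1P[<-|u0] /predU1P[<-|v0].
- by rewrite !mulr0 addr0 ray0 op_xx.
- have v01 : 0 < v < 1 by rewrite v0.
  have := mul_lt01 p01' v01; rewrite mulr0 add0r => /andP[h _].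
  by rewrite ray0 !ray_gt0// op_comm ?op_I// op_mulr.
- have u01 : 0 < u < 1 by rewrite u0.
  have := mul_lt01 p01 u01; rewrite mulr0 addr0 => /andP[h _].
  by rewrite ray0 !ray_gt0// op_mulr.
- have h : 0 < p * u + (1 - p) * v by rewrite addr_gt0// mulr_gt0//; lra.
  by rewrite !ray_gt0// op_hom// ?u0 ?v0.
Qed.

Lemma ray_scale r u a y : 0 < r < 1 -> 0 <= u < 1 ->
  0 <= y <= 1 -> 0 <= a <= 1 -> op r (ray a y u) a = ray a y (r * u).
Proof.
move=> r01 u01 yI aI; rewrite -{2}(ray0 a y) ray_hom ?mulr0 ?addr0//.
by rewrite lexx ltr01.
Qed.

Lemma ray_inj a y u v : Eset op a -> fiber a y -> a < y ->
  0 <= u < 1 -> 0 <= v < 1 -> ray a y u = ray a y v -> u = v.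
Proof.
move=> Ea Cy ay u01 v01.
have lt u' v' : 0 <= u' -> u' < v' -> v' < 1 -> ray a y u' < ray a y v'.
  move=> u0' uv v1; have v0 : 0 < v' by lra.
  have v01' : 0 < v' < 1 by lra.
  rewrite (ray_gt0 _ _ v0); move: u0' uv; rewrite le_eqVlt => /predU1P[<-|u0] uv.
    by rewrite ray0; case: (fiber_ray Ea Cy ay v01').
  by rewrite (ray_gt0 _ _ u0); exact: fiber_ray_lt.
move=> h; case: (ltgtP u v) => // luv; exfalso.
  by have : ray a y u < ray a y v; [apply: lt; lra|rewrite h ltxx].
by have : ray a y v < ray a y u; [apply: lt; lra|rewrite h ltxx].
Qed.

(* [l] is the coordinate of [x] on the ray from [a] through [y]; for [l >= 1]
   it can only be read off after contracting towards [a] by some [s]. *)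
Definition coord a y x l s : Prop :=
  [/\ 0 < s < 1, s * l < 1 & op s x a = ray a y (s * l)].

Lemma coord_scale a y x l s r : 0 <= a <= 1 -> 0 <= y <= 1 -> 0 <= x <= 1 ->
  0 <= l -> 0 < r < 1 -> coord a y x l s -> coord a y x l (r * s).
Proof.
move=> aI yI xI l0 r01 [s01 sl h].
have sl01 : 0 <= s * l < 1 by rewrite sl mulr_ge0//; lra.
split; first exact: mul_lt01.
  by rewrite -mulrA; apply: le_lt_trans sl; rewrite ler_piMl; lra.
by rewrite -op_mulr// h ray_scale// mulrA.
Qed.

(** Contracting by [s' * s] turns both readings into the same point of the ray, where [ray_inj]
    applies. *)
Lemma coord_uniq a y x l l' s s' : Eset op a -> fiber a y -> a < y ->
  0 <= x <= 1 -> 0 <= l -> 0 <= l' ->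
  coord a y x l s -> coord a y x l' s' -> l = l'.
Proof.
move=> Ea Cy ay xI l0 l0' ch ch'; case: (Ea) (Cy) => a01 _ [y1 _].
have yI : 0 <= y <= 1 by lra.
have s01 : 0 < s < 1 by case: ch.
have s01' : 0 < s' < 1 by case: ch'.
have [ss sl e] := coord_scale a01 yI xI l0 s01' ch.
have [_ sl' e'] := coord_scale a01 yI xI l0' s01 ch'.
rewrite (mulrC s) in e' sl'.
have ss0 : s' * s != 0 by rewrite gt_eqF//; case/andP: ss.
apply: (mulfI ss0); apply: (ray_inj Ea Cy ay); rewrite -?e -?e'//.
  by rewrite sl mulr_ge0//; lra.
by rewrite sl' mulr_ge0//; lra.
Qed.

(** Some contraction [op r x a] falls below [y], hence equals [op p y a] for some [p]; the
    coordinate is then [p / r]. *)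
Lemma coord_exists a y x : Eset op a -> fiber a y -> a < y -> fiber a x ->
  exists2 l, 0 <= l & exists s, coord a y x l s.
Proof.
move=> Ea Cy ay Cx; case: (Ea) (Cy) (Cx) => a01 _ [y1 _] [x1 _].
have h2 : 0 < (2^-1 : R) < 1 by lra.
have := x1; rewrite le_eqVlt => /andP[/predU1P[ax|ax] _].
  by exists 0 => //; exists 2^-1; split=> //; rewrite mulr0 ?ray0 -?ax ?op_xx.
have [r r01 ry] := fiber_ray_small Ea Cx ax ay.
have [Cr ar] := fiber_ray Ea Cx ax r01.
have ary : a < op r x a < y by rewrite ar.
have [p p01 hp] := fiber_ray_surj Ea Cy ary.
have r0 : 0 < r by lra.
exists (p / r); first by rewrite divr_ge0//; lra.
exists r; rewrite /coord mulrC divfK ?gt_eqF//; split=> //; first by lra.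
by rewrite ray_gt0 ?hp//; lra.
Qed.

Lemma coord_hom p a y x x' l l' s : 0 < p < 1 ->
  0 <= a <= 1 -> 0 <= y <= 1 -> 0 <= x <= 1 -> 0 <= x' <= 1 ->
  0 <= l -> 0 <= l' -> coord a y x l s -> coord a y x' l' s ->
  coord a y (op p x x') (p * l + (1 - p) * l') s.
Proof.
move=> p01 aI yI xI xI' l0 l0' [s01 sl e] [_ sl' e'].
have h : s * (p * l + (1 - p) * l') = p * (s * l) + (1 - p) * (s * l') by ring.
have k : 0 <= s * l by rewrite mulr_ge0//; lra.
have k' : 0 <= s * l' by rewrite mulr_ge0//; lra.
split=> //; rewrite h; first by nra.
by rewrite op_opl// e e' ray_hom// ?k ?k'.
Qed.

(* The choice of [y > a] as unit identifies the fiber with an interval of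
   nonnegative reals. *)
Lemma fiber_gauge a y : Eset op a -> fiber a y -> a < y ->
  exists g : R -> R, [/\ forall x, fiber a x -> 0 <= g x, g a = 0, g y = 1,
    forall x x', fiber a x -> fiber a x' -> x < x' -> g x < g x' &
    forall p x x', 0 < p < 1 -> fiber a x -> fiber a x' ->
      g (op p x x') = p * g x + (1 - p) * g x'].
Proof.
move=> Ea Cy ay; case: (Ea) (Cy) => a01 _ [y1 _].
have yI : 0 <= y <= 1 by lra.
have inI x : fiber a x -> 0 <= x <= 1 by case; lra.
have Ca : fiber a a by exact: fiber_base.
have h2 : 0 < (2^-1 : R) < 1 by lra.
have /choice[g gP] x : exists l, fiber a x -> 0 <= l /\ exists s, coord a y x l s.
  have [Cx|] := pselect (fiber a x); last by exists 0.
  by have [l l0 h] := coord_exists Ea Cy ay Cx; exists l.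
have gE x l s : fiber a x -> 0 <= l -> coord a y x l s -> g x = l.
  move=> Cx l0 h; have [g0 [s' h']] := gP _ Cx.
  exact: (coord_uniq Ea Cy ay (inI _ Cx) g0 l0 h' h).
have g_a : g a = 0.
  by apply: (gE _ _ 2^-1) => //; split; rewrite ?mulr0 ?ray0 ?op_xx.
have g_hom p x x' : 0 < p < 1 -> fiber a x -> fiber a x' ->
    g (op p x x') = p * g x + (1 - p) * g x'.
  move=> p01 Cx Cx'; have [l0 [s h]] := gP _ Cx; have [l0' [s' h']] := gP _ Cx'.
  have s01 : 0 < s < 1 by case: h.
  have s01' : 0 < s' < 1 by case: h'.
  have H := coord_scale a01 yI (inI _ Cx) l0 s01' h.
  have := coord_scale a01 yI (inI _ Cx') l0' s01 h'.
  rewrite (mulrC s) => H'.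
  apply: (gE _ _ (s' * s)); first exact: fiber_op.
    by rewrite addr_ge0// mulr_ge0//; lra.
  by apply: coord_hom => //; exact: inI.
have g_gt0 x : fiber a x -> a < x -> 0 < g x.
  move=> Cx ax; have [l0 [s [s01 _ h]]] := gP _ Cx.
  rewrite lt_neqAle l0 andbT eq_sym; apply/eqP => g0.
  move: h; rewrite g0 mulr0 ray0; have [_] := fiber_ray Ea Cx ax s01; lra.
exists g; split=> //.
- by move=> x /gP[].
- apply: (gE _ _ 2^-1) => //; split=> //; rewrite mulr1; first by lra.
  by rewrite ray_gt0//; lra.
- move=> x x' Cx Cx' xx'.
  have ax' : a < x' by case: Cx; lra.
  have := Cx => -[]; rewrite le_eqVlt => /andP[/predU1P[<-|ax] _] _.
    by rewrite g_a g_gt0.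
  have axx' : a < x < x' by rewrite ax.
  (* The smaller point lies on the ray through [x'], so its gauge is a proper fraction of [g x']. *)
  have [p p01 <-] := fiber_ray_surj Ea Cx' axx'.
  by rewrite g_hom// g_a mulr0 addr0 gtr_pMl ?g_gt0//; lra.
Qed.

(** The image of a gauge is thus an interval starting at 0; intermediate values occur on the ray
    through [x], at weight [v / g x]. *)
Lemma gauge_surj a g x v : Eset op a -> fiber a x -> g a = 0 ->
  (forall p x x', 0 < p < 1 -> fiber a x -> fiber a x' ->
    g (op p x x') = p * g x + (1 - p) * g x') ->
  0 <= v <= g x -> exists2 z, fiber a z & g z = v.
Proof.
move=> Ea Cx ga ghom; have Ca := fiber_base Ea.
rewrite !le_eqVlt => /andP[/predU1P[<- _|v0]]; first by exists a.
move=> /predU1P[->|vx]; first by exists x.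
have x0 : 0 < g x by lra.
have p01 : 0 < v / g x < 1 by rewrite divr_gt0 ?ltr_pdivrMr ?mul1r.
exists (op (v / g x) x a); first exact: fiber_op.
by rewrite ghom// ga mulr0 addr0 divfK// gt_eqF.
Qed.

(** * Isomorphism types of the fibers *)

Lemma Delta_fiber a b : Delta op (a, b) -> fiber a = `[a, b[%classic.
Proof.
move=> [/= [a01 a0] Eb ab E0]; case: (Eb) => b01 _.
apply/seteqP; split => x /=; rewrite in_itv /=.
  move=> [x1 xE]; apply/andP; split; first lra.
  by rewrite ltNge; apply/negP => /(xE _ Eb); lra.
move=> axb; split=> [|e Ee ex]; first lra.
rewrite leNgt; apply/negP => ae.
suff : (`]a, b[%classic `&` Eset op) e by rewrite E0.
by split=> //=; rewrite in_itv/=; lra.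
Qed.

(** The image of the gauge is an interval from 0 without greatest element: if unbounded it is [0,
    oo), if bounded it is [0, M) and is rescaled to [0, 1). *)
Lemma Delta_isomorphic a b : Delta op (a, b) ->
  exists t : \bar R, (t = 1%:E \/ t = +oo%E) /\
    ca_isomorphic `[a, b[%classic op [set x : R | 0 <= x /\ (x%:E < t)%E] (@stdop R).
Proof.
move=> D; have Cab := Delta_fiber D; case: (D) => /= Ea Eb ab _.
have Cx x : fiber a x <-> a <= x < b by rewrite Cab /= in_itv.
have Ca : fiber a a by exact: fiber_base.
pose y := (a + b) / 2.
have Cy : fiber a y by rewrite Cx /y; lra.
have ay : a < y by rewrite /y; lra.
have [g [g0 ga gy gmono ghom]] := fiber_gauge Ea Cy ay.
have ginj : {in fiber a &, injective g}.
  move=> x z /set_mem Hx /set_mem Hz gxz; case: (ltgtP x z) => // [xz|zx].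
    by have := gmono _ _ Hx Hz xz; rewrite gxz ltxx.
  by have := gmono _ _ Hz Hx zx; rewrite gxz ltxx.
have gup x : fiber a x -> exists2 z, fiber a z & g x < g z.
  move=> Hx; have /Cx axb := Hx; exists ((x + b) / 2); first by rewrite Cx; lra.
  by apply: gmono => //; [rewrite Cx; lra|lra].
rewrite -Cab; have [hb|hb] := pselect (has_ubound (g @` fiber a)); last first.
  exists +oo%E; split; first by right.
  exists g; split=> //; split=> // [x Hx|v [v0 _]] /=.
    by rewrite ltry; split=> //; exact: g0.
  have [x Hx vx] : exists2 x, fiber a x & v < g x.
    apply: contra_notP hb => h; exists v => _ [x Hx <-].
    by rewrite leNgt; apply/negP => vx; apply: h; exists x.
  have vgx : 0 <= v <= g x by rewrite v0 ltW.
  by have [z Hz gz] := gauge_surj Ea Hx ga ghom vgx; exists z.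
pose M := sup (g @` fiber a).
have hs : has_sup (g @` fiber a) by split=> //; exists (g a), a.
have gM x : fiber a x -> g x < M.
  move=> Hx; have [z Hz xz] := gup _ Hx; apply: lt_le_trans xz _.
  by apply: sup_upper_bound => //; exists z.
have M0 : 0 < M by rewrite -ga gM.
exists 1%E; split; first by left.
exists (fun x => g x / M); split; last first.
  by move=> p x z p01 Hx Hz; rewrite ghom// /stdop; field; rewrite gt_eqF.
split=> [x Hx|x z Hx Hz|v [v0]] /=.
- by rewrite lte_fin ltr_pdivrMr// mul1r gM// divr_ge0 ?g0// ltW.
- by move/(divIf (lt0r_neq0 M0)); exact: ginj.
- rewrite lte_fin => v1; have MvM : 0 < M - v * M by rewrite subr_gt0 gtr_pMl.
  have [_ [x Hx <-]] := sup_adherent MvM hs; rewrite -/M => hx.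
  have vgx : 0 <= v * M <= g x by rewrite mulr_ge0//=; lra.
  have [z Hz gz] := gauge_surj Ea Hx ga ghom vgx.
  by exists z => //; rewrite gz mulfK// gt_eqF.
Qed.

Lemma tau_isomorphic a b : Delta op (a, b) ->
  (tau op a b = 1%:E \/ tau op a b = +oo%E) /\
    ca_isomorphic (fiber a) op
      [set x : R | 0 <= x /\ (x%:E < tau op a b)%E] (@stdop R).
Proof.
move=> D; rewrite (Delta_fiber D).
exact: (xgetPex 0%E (Delta_isomorphic D)).
Qed.

(* [0] is the only extreme point of [[0, t)], and [a] is extreme in [[a, b)]. *)
Lemma isomorphic_base a (t : \bar R) g : Eset op a ->
  t = 1%:E \/ t = +oo%E ->
  set_bij (fiber a) [set x : R | 0 <= x /\ (x%:E < t)%E] g ->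
  (forall p x y, 0 < p < 1 -> fiber a x -> fiber a y ->
    g (op p x y) = stdop p (g x) (g y)) -> g a = 0.
Proof.
move=> Ea tE [gfun ginj gsurj] ghom.
have Ca : fiber a a by exact: fiber_base.
have [ga0 gat] := gfun _ Ca.
have := ga0; rewrite le_eqVlt => /predU1P[//|ga].
(* With [d] this small both [g a - d] and [g a + d] lie in [0, t), which makes [a] the midpoint of
   two other points. *)
have [d d0 [dt dl]] : exists2 d, 0 < d & ((g a + d)%:E < t)%E /\ d <= g a.
  case: tE gat => ->; last by exists (g a) => //; rewrite ltry.
  rewrite lte_fin => ga1.
  have [h|h] := leP (g a) ((1 - g a) / 2).
    by exists (g a) => //; rewrite lte_fin; split; lra.
  by exists ((1 - g a) / 2); rewrite ?lte_fin; [lra|split; lra].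
have [|u Cu gu] := gsurj (g a - d).
  by split; [lra|apply: le_lt_trans dt; rewrite lee_fin; lra].
have [|v Cv gv] := gsurj (g a + d); first by split=> //; lra.
have h2 : 0 < (2^-1 : R) < 1 by lra.
have Cuv := fiber_op Ea Cu Cv h2.
have ouv : op 2^-1 u v = a.
  apply: ginj; [exact: mem_set|exact: mem_set|].
  by rewrite ghom// gu gv /stdop; lra.
case: (Ea) (Cu) (Cv) => a01 _ [u1 _] [v1 _].
(* From [a < u] would follow [a < op 2^-1 u a <= op 2^-1 u v = a]. *)
have au : a < u -> False.
  move=> au; have [_] := fiber_ray Ea Cu au h2.
  by rewrite -{1}ouv ltNge op_mono//; lra.
have av : a < v -> False.
  move=> av; have [_] := fiber_ray Ea Cv av h2.
  have h2E : 1 - 2^-1 = 2^-1 :> R by lra.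
  rewrite -{1}ouv [op _ u v]op_comm ?h2E ?ltNge; try lra.
  by rewrite op_mono//; lra.
have ua : u = a by apply/eqP; rewrite eq_le leNgt; apply/andP; split; [exact/negP|lra].
by move: gu; rewrite ua; lra.
Qed.

(** With the point 1 as unit the gauge has greatest value 1, so its image is all of [0, 1]. *)
Lemma top_fiber_isomorphic a : Eset op a -> (forall e, Eset op e -> e <= a) ->
  a < 1 -> exists g, [/\ g a = 0,
    set_bij (fiber a) [set v | 0 <= v <= 1] g &
    forall p x x', 0 < p < 1 -> fiber a x -> fiber a x' ->
      g (op p x x') = stdop p (g x) (g x')].
Proof.
move=> Ea amax a1; case: (Ea) => a01 _.
have Cx x : fiber a x <-> a <= x <= 1.
  by split=> [[]//|x1]; split=> // e Ee _; exact: amax.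
have C1 : fiber a 1 by rewrite Cx; lra.
have [g [g0 ga gy gmono ghom]] := fiber_gauge Ea C1 a1.
exists g; split=> //; split=> [x Hx|x z /set_mem Hx /set_mem Hz gxz|v v01] /=.
- rewrite g0//= -gy; have := Hx; rewrite Cx => /andP[_].
  by rewrite le_eqVlt => /predU1P[->//|x1]; apply/ltW/gmono.
- case: (ltgtP x z) => // [xz|zx].
    by have := gmono _ _ Hx Hz xz; rewrite gxz ltxx.
  by have := gmono _ _ Hz Hx zx; rewrite gxz ltxx.
- have vg1 : 0 <= v <= g 1 by rewrite gy.
  by have [z Hz gz] := gauge_surj Ea C1 ga ghom vg1; exists z.
Qed.

(** * Decomposition of [0, 1] into fibers, and the role of the point 1 *)

(** If E has elements above [a], their infimum lies in E and is at least [x > a], hence is the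
    successor of [a] in E. *)
Lemma fiber_cases a x : Eset op a -> fiber a x -> a < x ->
  (exists b, Delta op (a, b)) \/ (forall e, Eset op e -> e <= a).
Proof.
move=> Ea [x1 xE] ax; pose S := [set e | Eset op e /\ a < e].
have [[e Se]|hS] := pselect (S !=set0); last first.
  right=> e Ee; rewrite leNgt; apply/negP => ae.
  by apply: hS; exists e.
have S0 : S !=set0 by exists e.
have Slb : lbound S x.
  move=> c [Ec ac]; rewrite leNgt; apply/negP => /ltW/(xE _ Ec); lra.
have xS : x <= inf S by apply: lb_le_inf.
left; exists (inf S); split=> //=; first by apply: Eset_inf => // c [].
  by apply: lt_le_trans xS.
apply/seteqP; split=> // c [/=]; rewrite in_itv/= => /andP[ac cS] Ec.
have : inf S <= c by apply: ge_inf; [exists x|].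
by rewrite leNgt cS.
Qed.

Lemma fiber_exists x : 0 <= x <= 1 -> exists2 a, Eset op a & fiber a x.
Proof.
move=> x01; pose S := [set e | Eset op e /\ e <= x].
have S0 : S !=set0 by exists 0; split; [exact: Eset0|lra].
have Sx : ubound S x by move=> e [].
have Es : Eset op (sup S) by apply: Eset_sup => // e [].
exists (sup S) => //; split; first by rewrite ge_sup//=; lra.
by move=> e Ee ex; apply: ub_le_sup => //; exists x.
Qed.

Lemma fiber_uniq a a' x : Eset op a -> Eset op a' -> fiber a x -> fiber a' x ->
  a = a'.
Proof.
move=> Ea Ea' [x1 xE] [x1' xE'].
by apply/eqP; rewrite eq_le xE'//= ?xE//; lra.
Qed.

(** The gluing rule: in a mixed combination the point of the lower fiber counts only as the base [b]
    of the upper one. *)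
Lemma op_fibers a b p x y : Eset op a -> Eset op b -> a < b ->
  fiber a x -> fiber b y -> 0 < p < 1 ->
  op p y x = op p y b /\ op p x y = op p b y.
Proof.
move=> [a01 _] Eb ab [x1 xE] [y1 _] p01; case: (Eb) => b01 _.
have xb : x <= b by rewrite leNgt; apply/negP => /ltW/(xE _ Eb); lra.
have h q : 0 < q < 1 -> op q y x = op q y b.
  by move=> q01; apply: Eset_absorb => //; lra.
split; first exact: h.
have p01' : 0 < 1 - p < 1 by lra.
by rewrite op_comm ?h//; try lra; rewrite [RHS]op_comm//; lra.
Qed.

Lemma max_of_EsetP : Eset op (max_of (Eset op)) /\
  forall e, Eset op e -> e <= max_of (Eset op).
Proof.
suff /(xgetPex 0)[] : exists x, (Eset op `&` ubound (Eset op)) x by [].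
have E0 : Eset op !=set0 by exists 0; exact: Eset0.
exists (sup (Eset op)); split; first exact: Eset_sup.
by apply: ub_le_sup; exists 1 => x [/andP[]].
Qed.

(** Turns the condition on the maximum into membership of 1 in E, which can be followed through an
    isomorphism. *)
Lemma max_of_Eset_lt1 : max_of (Eset op) < 1 <-> ~ Eset op 1.
Proof.
have [Em mmax] := max_of_EsetP; split=> [m1 /mmax|E1]; first by lra.
case: (Em) => m01 _; rewrite lt_neqAle (andP m01).2 andbT.
by apply/eqP => m1; rewrite m1 in Em.
Qed.

(** Describes the nonzero part of E by absorption alone, so that isomorphisms preserve it. *)
Lemma Eset_gt0P y : 0 <= y <= 1 ->
  (Eset op y /\ 0 < y) <-> exists z, [/\ 0 <= z <= 1, z != y & triangle op y z].
Proof.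
move=> y01; split=> [[[_ y0] ygt0]|[z [z01 zy yz]]].
  by exists 0; split=> //; [lra|rewrite lt_eqF].
have := triangle_lt y01 z01 yz; rewrite le_eqVlt (negbTE zy) /= => ltzy.
have zy1 : z < y <= 1 by lra.
split; last lra.
by apply: triangle_Eset zy1 yz; lra.
Qed.

End UnitIntervalAlgebra.

(** * Composing and inverting isomorphisms *)

Section Isomorphisms.
Set Implicit Arguments.
Unset Strict Implicit.
Context {R : realType}.
Implicit Types (A B C : set R) (op : R -> R -> R -> R) (f g k : R -> R).

Definition op_closed A op : Prop :=
  forall p x y, 0 < p < 1 -> A x -> A y -> A (op p x y).

Definition op_morphism A op op' f : Prop :=
  forall p x y, 0 < p < 1 -> A x -> A y -> f (op p x y) = op' p (f x) (f y).

(** The map is [g] followed by the inverse of [g']; the last clause serves to follow base points. *)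
Lemma isomorphism_lift A B C op1 op2 op3 g g' :
  op_closed A op1 -> op_closed B op2 ->
  set_bij A C g -> op_morphism A op1 op3 g ->
  set_bij B C g' -> op_morphism B op2 op3 g' ->
  exists k, [/\ set_bij A B k, op_morphism A op1 op2 k &
    forall x, A x -> g' (k x) = g x].
Proof.
move=> Acl Bcl [gfun ginj gsurj] ghom [gfun' ginj' gsurj'] ghom'.
have /choice[k kP] x : exists y, A x -> B y /\ g' y = g x.
  have [Ax|] := pselect (A x); last by exists 0.
  by have [y By gy] := gsurj' _ (gfun _ Ax); exists y.
have kB x : A x -> B (k x) by move=> /kP[].
have kg x : A x -> g' (k x) = g x by move=> /kP[].
exists k; split=> //; first split=> //.
- move=> x y /set_mem Ax /set_mem Ay kxy; apply: ginj; rewrite ?inE//.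
  by rewrite -!kg// kxy.
- move=> y By; have [x Ax gx] := gsurj _ (gfun' _ By).
  exists x => //; apply: ginj'; rewrite ?inE//; first exact: kB.
  by rewrite kg.
move=> p x y p01 Ax Ay; apply: ginj'; rewrite ?inE.
- exact/kB/Acl.
- exact: Bcl (kB _ _) (kB _ _).
- by rewrite ghom' ?kg ?ghom//; [exact: Acl|exact: kB|exact: kB].
Qed.

Lemma ca_isomorphic_trans A B C op1 op2 op3 : op_closed A op1 ->
  ca_isomorphic A op1 B op2 -> ca_isomorphic B op2 C op3 ->
  ca_isomorphic A op1 C op3.
Proof.
move=> Acl [f [[ffun finj fsurj] fhom]] [g [[gfun ginj gsurj] ghom]].
exists (g \o f); split; last first.
  by move=> p x y p01 Ax Ay; rewrite /= fhom// ghom//; exact: ffun.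
split=> [x /ffun/gfun//|x y Ax Ay /ginj fxy|z /gsurj[y /fsurj[x Ax <-] <-]].
  by apply: finj => //; apply: fxy; rewrite inE; apply/ffun/set_mem.
by exists x.
Qed.

Lemma ca_isomorphic_sym A B op op' : op_closed A op -> op_closed B op' ->
  ca_isomorphic A op B op' -> ca_isomorphic B op' A op.
Proof.
move=> Acl Bcl [f [fbij fhom]].
(* Lifting the identity of [B] along [f] yields the inverse of [f]. *)
have idbij : set_bij B B id by split=> // x Bx; exists x.
have [k [kbij khom _]] :=
  isomorphism_lift (op3 := op') Bcl Acl idbij (fun _ _ _ _ _ _ => erefl) fbij fhom.
by exists k.
Qed.

End Isomorphisms.

Section TwoAlgebras.
Set Implicit Arguments.
Unset Strict Implicit.
Context {R : realType}.
Variables op op' : R -> R -> R -> R.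
Hypothesis hop : convex_algebra `[0, 1]%classic op.
Hypotheses (hMO : MO op) (hUC : UC op) (hLC : LC op).
Hypothesis hop' : convex_algebra `[0, 1]%classic op'.
Hypotheses (hMO' : MO op') (hUC' : UC op') (hLC' : LC op').

(** * From equal invariants to an isomorphism *)

Section FromInvariants.
Variable phi : R -> R.
Hypothesis phi_bij : set_bij (Eset op) (Eset op') phi.
Hypothesis phi_lt :
  forall x y, Eset op x -> Eset op y -> x < y -> phi x < phi y.
Hypothesis phi_tau :
  forall a b, Delta op (a, b) -> tau op a b = tau op' (phi a) (phi b).
Hypothesis phi_max : max_of (Eset op) < 1 <-> max_of (Eset op') < 1.

Let phi_fun x : Eset op x -> Eset op' (phi x).
Proof. by case: phi_bij => + _ _; apply. Qed.

Let phi_ltE x y : Eset op x -> Eset op y -> (phi x < phi y) = (x < y).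
Proof.
move=> Ex Ey; apply/idP/idP; last exact: phi_lt.
case: (ltgtP x y) => // [yx|->]; last by rewrite ltxx.
by rewrite ltNge (ltW (phi_lt Ey Ex yx)).
Qed.

Let phi_leE x y : Eset op x -> Eset op y -> (phi x <= phi y) = (x <= y).
Proof. by move=> Ex Ey; rewrite !leNgt phi_ltE. Qed.

Let Delta_phi a b : Eset op a -> Eset op b ->
  Delta op' (phi a, phi b) <-> Delta op (a, b).
Proof.
case: phi_bij => _ _ phi_surj Ea Eb.
split=> -[/= _ _ ab E0]; split=> //=.
- by rewrite -phi_ltE.
- apply/seteqP; split=> // c [/=]; rewrite in_itv/= => /andP[ac cb] Ec.
  suff : (`]phi a, phi b[%classic `&` Eset op') (phi c) by rewrite E0.
  by split; [rewrite /= in_itv/= !phi_ltE// ac|exact: phi_fun].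
- exact: phi_fun.
- exact: phi_fun.
- by rewrite phi_ltE.
- apply/seteqP; split=> // d [/= + /phi_surj[c Ec cd]].
  rewrite -cd in_itv/= !phi_ltE// => acb.
  suff : (`]a, b[%classic `&` Eset op) c by rewrite E0.
  by split=> //=; rewrite in_itv.
Qed.

Let phi_top a : Eset op a -> (forall e, Eset op e -> e <= a) <->
  (forall e, Eset op' e -> e <= phi a).
Proof.
case: phi_bij => _ _ phi_surj Ea; split=> h e.
  by move=> /phi_surj[c Ec <-]; rewrite phi_leE// h.
by move=> Ee; rewrite -phi_leE// h//; exact: phi_fun.
Qed.

Let top_max (op1 : R -> R -> R -> R) (h1 : convex_algebra `[0, 1]%classic op1)
  (m1 : MO op1) a : Eset op1 a -> (forall e, Eset op1 e -> e <= a) ->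
  max_of (Eset op1) = a.
Proof.
move=> Ea ha; have [Em mmax] := max_of_EsetP h1 m1.
by apply/eqP; rewrite eq_le ha//= mmax.
Qed.

(** A fiber is the interval of a gap, a top fiber reaching up to 1, or a single point; [phi]
    preserves the case, and both fibers share a standard model. Base points must correspond for the
    later gluing. *)
Lemma fiber_isomorphism a : Eset op a ->
  exists k, [/\ set_bij (fiber op a) (fiber op' (phi a)) k,
    op_morphism (fiber op a) op op' k & k a = phi a].
Proof.
move=> Ea; have Ea' := phi_fun Ea.
have Cl : op_closed (fiber op a) op.
  by move=> p x y p01 Cx Cy; exact: (fiber_op hop hMO).
have Cl' : op_closed (fiber op' (phi a)) op'.
  by move=> p x y p01 Cx Cy; exact: (fiber_op hop' hMO').
have Ca := fiber_base Ea; have Ca' := fiber_base Ea'.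
have lift D op3 g g' : set_bij (fiber op a) D g ->
    op_morphism (fiber op a) op op3 g -> set_bij (fiber op' (phi a)) D g' ->
    op_morphism (fiber op' (phi a)) op' op3 g' -> g a = g' (phi a) ->
    exists k, [/\ set_bij (fiber op a) (fiber op' (phi a)) k,
      op_morphism (fiber op a) op op' k & k a = phi a].
  move=> gbij ghom gbij' ghom' gg.
  have [k [kbij khom kg]] := isomorphism_lift Cl Cl' gbij ghom gbij' ghom'.
  exists k; split=> //; case: gbij' kbij => _ ginj' _ [kfun _ _].
  by apply: ginj'; rewrite ?inE ?kg//; exact: kfun.
have [[b D]|noD] := pselect (exists b, Delta op (a, b)).
  have Eb : Eset op b by case: D.
  have D' : Delta op' (phi a, phi b) by rewrite Delta_phi.
  have [tE [g [gbij ghom]]] := tau_isomorphic hop hMO hUC hLC D.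
  have [tE' [g' [gbij' ghom']]] := tau_isomorphic hop' hMO' hUC' hLC' D'.
  have ga := isomorphic_base hop hMO hLC Ea tE gbij ghom.
  have ga' := isomorphic_base hop' hMO' hLC' Ea' tE' gbij' ghom'.
  rewrite -(phi_tau D) in gbij'.
  by apply: lift gbij ghom gbij' ghom' _; rewrite ga ga'.
have [[amax a1]|ntop] := pselect ((forall e, Eset op e -> e <= a) /\ a < 1).
  have amax' := (phi_top Ea).1 amax.
  have a1' : phi a < 1.
    move: phi_max; rewrite (top_max hop hMO Ea amax).
    by rewrite (top_max hop' hMO' Ea' amax') => <-.
  have [g [ga gbij ghom]] := top_fiber_isomorphic hop hMO hUC hLC Ea amax a1.
  have [g' [ga' gbij' ghom']] :=
    top_fiber_isomorphic hop' hMO' hUC' hLC' Ea' amax' a1'.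
  by apply: lift gbij ghom gbij' ghom' _; rewrite ga ga'.
(* With no gap starting at [a], and [a] not a maximum below 1, both fibers shrink to their base
   points. *)
have sgl x : fiber op a x -> x = a.
  move=> Cx; have [x1 _] := Cx; move: x1.
  rewrite le_eqVlt => /andP[/predU1P[//|ax] x1].
  have [//|amax] := fiber_cases hop hMO hUC Ea Cx ax.
  by exfalso; apply: ntop; split=> //; apply: lt_le_trans x1.
have sgl' x : fiber op' (phi a) x -> x = phi a.
  move=> Cx; have [x1 _] := Cx; move: x1.
  rewrite le_eqVlt => /andP[/predU1P[//|ax] x1]; exfalso.
  have [[b' D']|amax'] := fiber_cases hop' hMO' hUC' Ea' Cx ax.
    case: phi_bij => _ _ phi_surj.
    have [_ /phi_surj[b Eb bb'] _ _] := D'.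
    by apply: noD; exists b; rewrite -Delta_phi// bb'.
  have amax := (phi_top Ea).2 amax'; apply: ntop; split=> //.
  move: phi_max; rewrite (top_max hop hMO Ea amax) (top_max hop' hMO' Ea' amax').
  by case=> _; apply; apply: lt_le_trans x1.
exists (fun=> phi a); split=> //.
  split=> [x _ //|x y /set_mem/sgl-> /set_mem/sgl->//|x /sgl'->].
  by exists a.
by move=> p x y p01 _ _; rewrite (op_xx hop')//; case: Ea'.
Qed.

Lemma isomorphic_of_invariants :
  ca_isomorphic `[0, 1]%classic op `[0, 1]%classic op'.
Proof.
have /choice[K KP] a : exists k, Eset op a ->
    [/\ set_bij (fiber op a) (fiber op' (phi a)) k,
      op_morphism (fiber op a) op op' k & k a = phi a].
  have [/fiber_isomorphism[k kP]|] := pselect (Eset op a); first by exists k.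
  by exists id.
have /choice[B BP] x : exists a, 0 <= x <= 1 -> Eset op a /\ fiber op a x.
  have [/(fiber_exists hop hMO)[a Ea Cx]|] := pselect (0 <= x <= 1).
    by exists a.
  by exists 0.
(* [B x] is the base of the fiber of [x], and [K] picks one isomorphism for each base. *)
pose f x := K (B x) x.
have fE a x : Eset op a -> fiber op a x -> f x = K a x.
  move=> Ea Cx; have x01 : 0 <= x <= 1 by case: Ea Cx => a01 _ [x1 _]; lra.
  have [EB CB] := BP _ x01.
  by rewrite /f (fiber_uniq EB Ea CB Cx).
have ffib a x : Eset op a -> fiber op a x -> fiber op' (phi a) (f x).
  by move=> Ea Cx; rewrite (fE _ _ Ea Cx); have [[+ _ _] _ _] := KP _ Ea; apply.
have fbase a : Eset op a -> f a = phi a.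
  move=> Ea; rewrite (fE _ _ Ea (fiber_base Ea)).
  by have [] := KP _ Ea.
have fib_I a x : Eset op' a -> fiber op' a x -> 0 <= x <= 1.
  by move=> [a01 _] [x1 _]; lra.
exists f; split; last first.
  move=> p x y p01; rewrite /= !in_itv/= => x01 y01.
  move: (BP _ x01) (BP _ y01); move: (B x) (B y) => a b [Ea Cx] [Eb Cy].
  case: (ltgtP a b) => ab.
  (* In both algebras the lower point is replaced by the upper base; the replacements agree as [K b]
     sends [b] to [phi b]. *)
  - have [_ ->] := op_fibers hop hMO hLC Ea Eb ab Cx Cy p01.
    have Cb := fiber_base Eb; have [_ khom kb] := KP _ Eb.
    have ab' : phi a < phi b by exact: phi_lt.
    have [_ ->] := op_fibers hop' hMO' hLC' (phi_fun Ea) (phi_fun Eb) ab'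
      (ffib _ _ Ea Cx) (ffib _ _ Eb Cy) p01.
    rewrite (fE _ _ Eb (fiber_op hop hMO Eb Cb Cy p01)) khom// kb.
    by rewrite (fE _ _ Eb Cy).
  - have [-> _] := op_fibers hop hMO hLC Eb Ea ab Cy Cx p01.
    have Ca := fiber_base Ea; have [_ khom ka] := KP _ Ea.
    have ab' : phi b < phi a by exact: phi_lt.
    have [-> _] := op_fibers hop' hMO' hLC' (phi_fun Eb) (phi_fun Ea) ab'
      (ffib _ _ Eb Cy) (ffib _ _ Ea Cx) p01.
    rewrite (fE _ _ Ea (fiber_op hop hMO Ea Cx Ca p01)) khom// ka.
    by rewrite (fE _ _ Ea Cx).
  - subst b; have [_ khom _] := KP _ Ea.
    rewrite (fE _ _ Ea (fiber_op hop hMO Ea Cx Cy p01)) khom//.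
    by rewrite (fE _ _ Ea Cx) (fE _ _ Ea Cy).
split.
- move=> x /=; rewrite !in_itv/= => /BP[Ea Cx].
  by apply: fib_I (ffib _ _ Ea Cx); exact: phi_fun.
- move=> x y; rewrite !inE /= !in_itv/= => /BP[Ea Cx] /BP[Eb Cy] fxy.
  have Cfx := ffib _ _ Ea Cx; have Cfy := ffib _ _ Eb Cy.
  rewrite -fxy in Cfy.
  have pab := fiber_uniq (phi_fun Ea) (phi_fun Eb) Cfx Cfy.
  have ab : B x = B y by case: phi_bij => _ + _; apply; rewrite ?inE.
  rewrite -ab in Cy; have [[_ kinj _] _ _] := KP _ Ea.
  by apply: kinj; rewrite ?inE// -(fE _ _ Ea Cx) -(fE _ _ Ea Cy).
- move=> y; rewrite /= in_itv/= => /(fiber_exists hop' hMO')[a' Ea' Cy].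
  case: phi_bij => _ _ /(_ _ Ea')[a Ea aa'].
  have [[_ _ ksurj] _ _] := KP _ Ea; rewrite -aa' in Cy.
  have [x Cx kx] := ksurj _ Cy; exists x.
    by case: Ea Cx => a01 _ [x1 _]; rewrite /= in_itv/=; lra.
  by rewrite (fE _ _ Ea Cx).
Qed.

End FromInvariants.

(** * From an isomorphism to equal invariants *)

Section FromIsomorphism.
Variable f : R -> R.
Hypothesis f_bij : set_bij `[0, 1]%classic `[0, 1]%classic f.
Hypothesis f_hom : op_morphism `[0, 1]%classic op op' f.

Let f_I x : 0 <= x <= 1 -> 0 <= f x <= 1.
Proof. by case: f_bij => /(_ x) + _ _; rewrite /= !in_itv. Qed.

Let f_inj x y : 0 <= x <= 1 -> 0 <= y <= 1 -> f x = f y -> x = y.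
Proof. by case: f_bij => _ /(_ x y) + _ xI yI; rewrite !inE /= !in_itv; apply. Qed.

Let f_surj y : 0 <= y <= 1 -> exists2 x, 0 <= x <= 1 & f x = y.
Proof.
case: f_bij => _ _ /(_ y) + yI; rewrite /= in_itv => /(_ yI)[x].
by rewrite /= in_itv; exists x.
Qed.

Let f_triangle x y : 0 <= x <= 1 -> 0 <= y <= 1 ->
  triangle op' (f x) (f y) <-> triangle op x y.
Proof.
move=> xI yI; split=> h t t01; last by rewrite -f_hom ?h//= in_itv.
by apply: f_inj => //; [exact: (op_I hop)|rewrite f_hom ?h//= in_itv].
Qed.

Let f_Eset_gt0 x : 0 <= x <= 1 ->
  (Eset op' (f x) /\ 0 < f x) <-> (Eset op x /\ 0 < x).
Proof.
move=> xI; rewrite (Eset_gt0P hop hMO hLC)// (Eset_gt0P hop' hMO' hLC') ?f_I//.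
split=> [[_ [/f_surj[z zI <-] zx /f_triangle h]]|[z [zI zx h]]].
  by exists z; split=> //; [apply: contraNN zx => /eqP->|exact: h].
exists (f z); split; [exact: f_I| |exact/f_triangle].
by apply: contraNN zx => /eqP/f_inj->.
Qed.

(** Within [0, 1] such a [y] absorbs exactly the points up to [y], so comparison with [y] is
    algebraic and survives under [f]. *)
Let f_le x y : Eset op y -> 0 < y -> 0 <= x <= 1 -> (f x <= f y) = (x <= y).
Proof.
move=> Ey y0 xI; have yI : 0 <= y <= 1 by case: Ey.
have [Ey' _] := (f_Eset_gt0 yI).2 (conj Ey y0).
have h := Eset_triangle hop hMO hLC Ey xI.
have h' := Eset_triangle hop' hMO' hLC' Ey' (f_I xI).
by apply/idP/idP; rewrite -?h -?h' f_triangle.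
Qed.

Let f_lt x y : Eset op y -> 0 < y -> 0 <= x <= 1 -> (f x < f y) = (x < y).
Proof.
move=> Ey y0 xI; have yI : 0 <= y <= 1 by case: Ey.
rewrite !lt_neqAle f_le//; congr (~~ _ && _).
by apply/eqP/eqP => [/f_inj->|->].
Qed.

(* [f] need not fix [0], e.g. the reflection of [[0, 1]] when E is [{0}]. *)
Let phi x := if x == 0 then 0 else f x.

Let phi_gt0 x : 0 < x -> phi x = f x.
Proof. by move=> x0; rewrite /phi gt_eqF. Qed.

Let phi0 : phi 0 = 0.
Proof. by rewrite /phi eqxx. Qed.

Let Eset_cases x : Eset op x -> x = 0 \/ [/\ 0 < x, Eset op' (f x) & 0 < f x].
Proof.
move=> Ex; case: (Ex) => xI _.
have /andP[] := xI; rewrite le_eqVlt => /predU1P[<-|x0] _; [by left|right].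
by have [] := (f_Eset_gt0 xI).2 (conj Ex x0).
Qed.

Let phi_lt x y : Eset op x -> Eset op y -> x < y -> phi x < phi y.
Proof.
move=> Ex Ey xy; have xI : 0 <= x <= 1 by case: Ex.
have y0 : 0 < y by lra.
rewrite (phi_gt0 y0); have [->|[x0 _ _]] := Eset_cases Ex.
  by rewrite phi0; have [e|[]//] := Eset_cases Ey; rewrite e ltxx in y0.
by rewrite phi_gt0// f_lt.
Qed.

Let phi_bij : set_bij (Eset op) (Eset op') phi.
Proof.
split.
- move=> x /Eset_cases[->|[x0 + _]]; last by rewrite phi_gt0.
  by rewrite phi0 => *; exact: (Eset0 hop').
- move=> x y /set_mem Ex /set_mem Ey pxy; case: (ltgtP x y) => // [xy|yx].
    by have := phi_lt Ex Ey xy; rewrite pxy ltxx.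
  by have := phi_lt Ey Ex yx; rewrite pxy ltxx.
- move=> y Ey; case: (Ey) => yI _; have /andP[] := yI.
  rewrite le_eqVlt => /predU1P[<-|y0] _.
    by exists 0 => //; exact: (Eset0 hop).
  have [x xI xy] := f_surj yI; subst y.
  have [Ex x0] := (f_Eset_gt0 xI).1 (conj Ey y0).
  by exists x => //; rewrite phi_gt0.
Qed.

(** The map is [f] itself, since it respects comparison with nonzero elements of E. *)
Let phi_isomorphic a b : Delta op (a, b) ->
  ca_isomorphic `[a, b[%classic op `[phi a, phi b[%classic op'.
Proof.
move=> [/= Ea Eb ab _]; have aI : 0 <= a <= 1 by case: Ea.
have bI : 0 <= b <= 1 by case: Eb.
have b0 : 0 < b by lra.
have fE x : 0 <= x <= 1 -> (phi a <= f x < phi b) = (a <= x < b).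
  move=> xI; rewrite (phi_gt0 b0) f_lt//; congr andb.
  have [->|[a0 _ _]] := Eset_cases Ea.
    (* For [a = 0] both lower bounds hold on all of [0, 1]. *)
    by rewrite phi0; have := f_I xI; have := xI; do 2 case/andP=> -> _.
  rewrite phi_gt0// le_eqVlt [RHS]le_eqVlt; congr orb.
    by apply/eqP/eqP => [/f_inj->|->].
  by rewrite !ltNge f_le.
have sub x : a <= x < b -> 0 <= x <= 1 by lra.
exists f; split; last first.
  move=> p x y p01; rewrite /= !in_itv/= => /sub xI /sub yI.
  by apply: f_hom; rewrite //= in_itv.
split.
- by move=> x; rewrite /= !in_itv/= => axb; rewrite fE//; exact: sub.
- by move=> x y; rewrite !inE /= !in_itv/= => /sub xI /sub yI; exact: f_inj.
- move=> y; rewrite /= in_itv/= => yab.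
  have [|x xI xy] := @f_surj y.
    case: phi_bij => /(_ _ Ea)[pa _] _ _; case: phi_bij => /(_ _ Eb)[pb _] _ _.
    by lra.
  by exists x => //=; rewrite in_itv/= -fE// xy.
Qed.

Lemma invariants_of_isomorphism :
  (exists phi : R -> R,
     [/\ set_bij (Eset op) (Eset op') phi,
         forall x y, Eset op x -> Eset op y -> x < y -> phi x < phi y &
         forall a b, Delta op (a, b) -> tau op a b = tau op' (phi a) (phi b)])
  /\ (max_of (Eset op) < 1 <-> max_of (Eset op') < 1).
Proof.
split.
  (* Isomorphic subalgebras admit the same values [t], so [xget] chooses from equal sets. *)
  exists phi; split=> // a b D; congr (xget _ _).
  have iso := phi_isomorphic D.
  have cl : op_closed `[a, b[%classic op.
    rewrite -(Delta_fiber D) => p x y p01 Cx Cy.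
    by apply: (fiber_op hop hMO) => //; case: D.
  have cl' : op_closed `[phi a, phi b[%classic op'.
    case: iso => g [[gfun _ gsurj] ghom] p _ _ p01 /gsurj[x Cx <-] /gsurj[y Cy <-].
    by rewrite -ghom//; apply/gfun/cl.
  have iso' := ca_isomorphic_sym cl cl' iso.
  apply/seteqP; split=> t [tE h]; split=> //.
    exact: ca_isomorphic_trans cl' iso' h.
  exact: ca_isomorphic_trans cl iso h.
rewrite (max_of_Eset_lt1 hop hMO) (max_of_Eset_lt1 hop' hMO').
have I1 : 0 <= (1 : R) <= 1 by rewrite ler01 lexx.
suff : Eset op 1 <-> Eset op' 1 by move=> h; split=> h1 /h.
split=> E1.
  have [E1' _] := (f_Eset_gt0 I1).2 (conj E1 ltr01).
  (* As 1 is in E, [f] respects [z <= 1], so that [1 = f z <= f 1]. *)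
  have [z zI z1] := f_surj I1.
  suff <- : f 1 = 1 by [].
  apply/eqP; rewrite eq_le (andP (f_I I1)).2 -{1}z1 f_le//.
  by case/andP: zI.
have [x xI x1] := f_surj I1.
have [Ex x0] : Eset op x /\ 0 < x by apply/f_Eset_gt0; rewrite // x1.
suff <- : x = 1 by [].
apply/eqP; rewrite eq_le (andP xI).2 -f_le// x1.
by case/andP: (f_I I1).
Qed.

End FromIsomorphism.
End TwoAlgebras.

Theorem theorem3p7 (R : realType) (op op' : R -> R -> R -> R)
  (hop : convex_algebra `[0, 1]%classic op)
  (hMO : MO op) (hUC : UC op) (hLC : LC op)
  (hop' : convex_algebra `[0, 1]%classic op')
  (hMO' : MO op') (hUC' : UC op') (hLC' : LC op') :
  ca_isomorphic `[0, 1]%classic op `[0, 1]%classic op' <->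
  (exists phi : R -> R,
     [/\ set_bij (Eset op) (Eset op') phi,
         forall x y, Eset op x -> Eset op y -> x < y -> phi x < phi y &
         forall a b, Delta op (a, b) -> tau op a b = tau op' (phi a) (phi b)])
  /\ (max_of (Eset op) < 1 <-> max_of (Eset op') < 1).
Proof.
split=> [[f [fbij fhom]]|[[phi [phi_bij phi_lt phi_tau]] phi_max]].
  exact: (invariants_of_isomorphism hop hMO hLC hop' hMO' hLC' fbij fhom).
exact: (isomorphic_of_invariants hop hMO hUC hLC hop' hMO' hUC' hLC' phi_bij
  phi_lt phi_tau phi_max).
Qed.
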